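(* Let $(M,F)$ be a conic pseudo-Finsler surface and let $\overline F=e^{\phi}F$ be a proper anisotropic conformal change of $F$. The change satisfies the vertical $\phi T$-condition if and only if $F$ has a vanishing $T$-tensor.
   Context: $M$ is a smooth 2-dimensional manifold with local coordinates $(x^i)$ and induced coordinates $(x^i,y^i)$ on $TM$; $\dot\partial_i=\partial/\partial y^i$. $\mathcal A\subset TM_0=TM\setminus(0)$ is a conic sub-bundle (non-empty, open, invariant under $y\mapsto\lambda y$, $\lambda>0$, projecting onto $M$). A function is $h(r)$ if it is positively homogeneous of degree $r$ in $y$. A conic pseudo-Finsler metric is a smooth $h(1)$ function $F:\mathcal A\to\mathbb R$ with $g_{ij}=\frac12\dot\partial_i\dot\partial_jF^2$ non-degenerate. Modified Berwald frame: $\ell_i=\dot\partial_iF$, $\ell^i=y^i/F$, $g_{ij}=\ell_i\ell_j+\varepsilon m_im_j$ with $\varepsilon=\pm1$, $m^i=g^{ij}m_j$. The main scalar $\mathcal I$ is defined by $FC_{ijk}=\mathcal I m_im_jm_k$, where $C_{ijk}=\frac12\dot\partial_kg_{ij}$. For smooth $f$ on $\mathcal A$: $F\dot\partial_if=f_{;1}\ell_i+f_{;2}m_i$. The $T$-tensor of $F$ is given by $FT_{ijkh}=\mathcal I_{;2}m_im_jm_km_h$, and $FT^i_{jkr}=\mathcal I_{;2}m^im_jm_km_r$. An anisotropic conformal change of $F$ is $\overline F=e^{\phi(x,y)}F$ with $\phi$ a smooth $h(0)$ function on $\mathcal A$ such that $\varepsilon+\sigma-(\phi_{;2})^2\ne0$,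 where $\sigma=\phi_{;2;2}+\varepsilon\mathcal I\phi_{;2}+2(\phi_{;2})^2$. It is proper if $\phi_{;2}\neq0$. A proper change satisfies the vertical $\phi T$-condition if $(\dot\partial_i\phi)T^i_{jkr}=0$. *)

(* Defs.v *)
From HB Require Import structures.
From mathcomp Require Import all_boot all_order all_algebra.
From mathcomp Require Import all_classical all_reals all_analysis.
Set Implicit Arguments.
Unset Strict Implicit.
Unset Printing Implicit Defensive.
Import Order.TTheory GRing.Theory Num.Theory.
Import numFieldNormedType.Exports.
Local Open Scope classical_set_scope.
Local Open Scope ring_scope.

(* C^oo maps on an open set U: every iterated directional derivative (in
   arbitrary directions, of any order including 0) is differentiable on U. *)
Section Smooth.
Variables (R : realType) (V W : normedModType R).

Definition iter_derive (f : V -> W) (vs : seq V) : V -> W :=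
  foldr (fun v g => fun x => 'D_v g x) f vs.

Definition smooth_on (U : set V) (f : V -> W) : Prop :=
  forall (vs : seq V) (x : V), U x -> differentiable (iter_derive f vs) x.

End Smooth.

(* Smooth 2-dimensional manifold structure on the space M, given by an atlas
   (possibly, but not necessarily, maximal). The map [coord c] is only
   meaningful on [dom c], and [param c], its inverse, only on [img c]. *)
Record smooth_surface (R : realType) (M : topologicalType) := SmoothSurface {
  chart : Type;
  dom : chart -> set M;
  img : chart -> set 'rV[R]_2;
  coord : chart -> M -> 'rV[R]_2;
  param : chart -> 'rV[R]_2 -> M;
  surface_hausdorff : hausdorff_space M;
  surface_second_countable : @second_countable M;
  dom_open : forall c, open (dom c);
  img_open : forall c, open (img c);
  coord_img : forall c p, dom c p -> img c (coord c p);
  param_dom : forall c x, img c x -> dom c (param c x);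
  coordK : forall c p, dom c p -> param c (coord c p) = p;
  paramK : forall c x, img c x -> coord c (param c x) = x;
  coord_continuous : forall c, {within dom c, continuous (coord c)};
  param_continuous : forall c, {within img c, continuous (param c)};
  dom_cover : forall p, exists c, dom c p;
  transition_smooth : forall c d,
    smooth_on [set x | img c x /\ dom d (param c x)] (coord d \o param c)
}.

Section TangentBundle.
Variables (R : realType) (M : topologicalType) (S : smooth_surface R M).

(* The total space of TM: a tangent vector at [base] is given by its
   components (y^1, y^2) in all the charts around [base], related by the
   Jacobians of the changes of coordinates; components in the other charts
   are set to 0 so that equality of tangent vectors is Leibniz equality. *)
Record tangent := Tangent {
  base : M;
  comp : chart S -> 'rV[R]_2;
  compE : forall c d, dom c base -> dom d base ->
    comp d = 'd (coord d \o param c) (coord c base) (comp c);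
  comp_out : forall c, ~ dom c base -> comp c = 0
}.

(* Coordinate space (x^1, x^2, y^1, y^2) of TM. *)
Definition TR2 : normedModType R := ('rV[R]_2 * 'rV[R]_2)%type.

Definition tcoord (c : chart S) (v : tangent) : TR2 :=
  (coord c (base v), comp v c).

Definition tcoord_img (A : set tangent) (c : chart S) : set TR2 :=
  [set tcoord c v | v in A `&` [set v | dom c (base v)]].

(* Expression of a function on TM in the coordinates (x^i, y^i); there is
   exactly one v over [dom c] with given coordinates in [img c] x R^2. *)
Definition local_expr (c : chart S) (f : tangent -> R) : TR2 -> R :=
  fun z => get [set r | exists v,
    [/\ dom c (base v), tcoord c v = z & r = f v]].

Definition smooth_on_TM (A : set tangent) (f : tangent -> R) : Prop :=
  forall c, smooth_on (tcoord_img A c) (local_expr c f).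

(* [w] is the tangent vector l y at the same point, where [v] is y. *)
Definition is_scaling (l : R) (v w : tangent) : Prop :=
  base w = base v /\ forall c, comp w c = l *: comp v c.

Definition pos_homogeneous (r : int) (A : set tangent) (f : tangent -> R) :=
  forall (l : R) v w, 0 < l -> A v -> is_scaling l v w -> f w = l ^ r * f v.

Record conic_subbundle (A : set tangent) : Prop := ConicSubbundle {
  conic_nonempty : A !=set0;
  conic_slit : forall v, A v -> forall c, dom c (base v) -> comp v c <> 0;
  conic_open : forall c, open (tcoord_img A c);
  conic_scale : forall (l : R) v w, 0 < l -> A v -> is_scaling l v w -> A w;
  conic_onto : base @` A = setT
}.

End TangentBundle.

(* Local tensor calculus on the coordinate space of TM; z = (x, y). *)
Section LocalFinsler.
Variable R : realType.
Implicit Types (f F : TR2 R -> R) (z : TR2 R) (i j k : 'I_2).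

Definition vpartial i f : TR2 R -> R :=
  fun z => 'D_((0, delta_mx 0 i) : TR2 R) f z.

Definition gmetric F z : 'M[R]_2 :=
  \matrix_(i, j) (2^-1 * vpartial i (vpartial j (fun w => F w ^+ 2)) z).

Definition ell F z i : R := vpartial i F z.

Definition cartan F z i j k : R :=
  2^-1 * vpartial k (fun w => gmetric F w i j) z.

Variables (F : TR2 R -> R) (m : TR2 R -> 'I_2 -> R).

Definition m_up z i : R := \sum_j invmx (gmetric F z) i j * m z j.

(* [vderiv f z] is the pair (f_{;1}, f_{;2}), that is the coefficients of
   F \dot\partial_i f = f_{;1} l_i + f_{;2} m_i (they are unique, (l_i, m_i)
   being a coframe). *)
Definition vderiv f z : R * R :=
  get [set ab : R * R |
    forall i, F z * vpartial i f z = ab.1 * ell F z i + ab.2 * m z i].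

Definition vderiv1 f : TR2 R -> R := fun z => (vderiv f z).1.
Definition vderiv2 f : TR2 R -> R := fun z => (vderiv f z).2.

Definition main_scalar : TR2 R -> R := fun z =>
  get [set I : R |
    forall i j k, F z * cartan F z i j k = I * m z i * m z j * m z k].

(* In dimension 2, F has no zero where g is non-degenerate (if F = 0 then
   g_ij = l_i l_j), so that the divisions by F are genuine. *)
Definition Ttensor z i j k h : R :=
  vderiv2 main_scalar z * m z i * m z j * m z k * m z h / F z.

(* T^i_jkr, first index raised. *)
Definition Ttensor_up z i j k r : R :=
  vderiv2 main_scalar z * m_up z i * m z j * m z k * m z r / F z.

End LocalFinsler.

Section Finsler.
Variables (R : realType) (M : topologicalType) (S : smooth_surface R M).
Variables (A : set (tangent S)) (F : tangent S -> R).

Record conic_pseudo_finsler : Prop := ConicPseudoFinsler {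
  finsler_conic : conic_subbundle A;
  finsler_smooth : smooth_on_TM A F;
  finsler_homogeneous : pos_homogeneous 1 A F;
  finsler_nondegenerate : forall c z, tcoord_img A c z ->
    gmetric (local_expr c F) z \in unitmx
}.

(* Modified Berwald frame, in each chart. The covector m_i is determined by
   the equation up to a sign, and on a non-orientable surface the sign may be
   impossible to choose globally; hence one choice for each chart, without
   compatibility condition. In a chart such a frame always exists: m is a
   multiple of (-y^2, y^1). The conditions stated below do not depend on the
   choice of sign. By smoothness of m, [frame_eps] is locally constant. *)
Record berwald_frame := BerwaldFrame {
  frame_eps : chart S -> TR2 R -> R;
  frame_m : chart S -> TR2 R -> 'I_2 -> R;
  frame_epsE : forall c z, tcoord_img A c z ->
    frame_eps c z = 1 \/ frame_eps c z = -1;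
  frame_m_smooth : forall c i,
    smooth_on (tcoord_img A c) (fun z => frame_m c z i);
  frame_metric : forall c z i j, tcoord_img A c z ->
    gmetric (local_expr c F) z i j =
      ell (local_expr c F) z i * ell (local_expr c F) z j
      + frame_eps c z * frame_m c z i * frame_m c z j
}.

Variable B : berwald_frame.

Definition frame_vderiv2 (c : chart S) : (TR2 R -> R) -> TR2 R -> R :=
  vderiv2 (local_expr c F) (frame_m B c).

Definition sigma (phi : tangent S -> R) (c : chart S) (z : TR2 R) : R :=
  let phi2 := frame_vderiv2 c (local_expr c phi) in
  frame_vderiv2 c phi2 z
  + frame_eps B c z * main_scalar (local_expr c F) (frame_m B c) z * phi2 z
  + 2 * phi2 z ^+ 2.

Record anisotropic_conformal_change (phi Fbar : tangent S -> R) : Prop :=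
  AnisotropicConformalChange {
  change_smooth : smooth_on_TM A phi;
  change_homogeneous : pos_homogeneous 0 A phi;
  change_nondegenerate : forall c z, tcoord_img A c z ->
    frame_eps B c z + sigma phi c z
      - frame_vderiv2 c (local_expr c phi) z ^+ 2 <> 0;
  changeE : forall v, A v -> Fbar v = expR (phi v) * F v
}.

Definition proper_change (phi : tangent S -> R) : Prop :=
  forall c z, tcoord_img A c z -> frame_vderiv2 c (local_expr c phi) z <> 0.

Definition vertical_phiT_condition (phi : tangent S -> R) : Prop :=
  forall c z j k r, tcoord_img A c z ->
    \sum_i vpartial i (local_expr c phi) z *
      Ttensor_up (local_expr c F) (frame_m B c) z i j k r = 0.

Definition vanishing_Ttensor : Prop :=
  forall c z i j k h, tcoord_img A c z ->
    Ttensor (local_expr c F) (frame_m B c) z i j k h = 0.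

End Finsler.

(* Main.v *)
Require Import Defs.
From mathcomp Require Import all_boot all_order all_algebra.
From mathcomp Require Import all_classical all_reals all_analysis.
From mathcomp Require Import ring.

(** Everything happens at one point of the coordinate space of TM. Write
    [G = I_{;2}], [l] and [m] for the two covectors of the Berwald frame, and
    [m^i] for the index-raised [m]. Both tensors are built from the
    same components [G m_j m_k m_r / F]: the T-tensor multiplies them by [m_i],
    while the phi-T condition multiplies them by the scalar
    [(\dot\partial_i phi) m^i].

    Since [g = l l + eps m m] is non-degenerate and [det g = eps det(l, m)^2],
    the pair [(l, m)] is a coframe ([coframe_det_neq0]). Expanding [g_ij m^j =
    m_i] in it gives [l_i m^i = 0] and [eps m_i m^i = 1] ([m_up_dual]), so that
    contracting [F \dot\partial_i phi = phi_{;1} l_i + phi_{;2} m_i] with [m^i]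
    yields [eps F (\dot\partial_i phi) m^i = phi_{;2}] ([contract_m_up]). For a
    proper change this scalar is therefore nonzero and the phi-T condition
    kills every [G m_j m_k m_r / F], hence the T-tensor. Conversely, if
    [G m_j m_j m_k m_r / F = 0] then [G m_j m_k m_r / F = 0], whether or not
    [m_j] vanishes. *)

Set Implicit Arguments.
Unset Strict Implicit.
Unset Printing Implicit Defensive.
Import Order.TTheory GRing.Theory Num.Theory.
Local Open Scope classical_set_scope.
Local Open Scope ring_scope.

Lemma det_mx22 (R : comNzRingType) (A : 'M[R]_2) :
  \det A = A 0 0 * A 1 1 - A 0 1 * A 1 0.
Proof.
rewrite (expand_det_row _ 0) !big_ord_recl big_ord0 /cofactor !det_mx11 !mxE /=.
rewrite addr0 expr0 mul1r expr1 mulN1r mulrN.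
by congr (_ * A _ _ - A _ _ * A _ _); apply/val_inj.
Qed.

Section BerwaldFrameAtPoint.
Variables (R : realType) (F : TR2 R -> R) (m : TR2 R -> 'I_2 -> R).
Variables (eps : R) (z : TR2 R).
Hypothesis g_unit : gmetric F z \in unitmx.
Hypothesis gE : forall i j,
  gmetric F z i j = ell F z i * ell F z j + eps * m z i * m z j.

(** The determinant of the pair of covectors [(l, m)]. *)
Definition coframe_det : R := ell F z 0 * m z 1 - ell F z 1 * m z 0.

Lemma coframe_det_neq0 : coframe_det != 0.
Proof.
have detE : \det (gmetric F z) = eps * coframe_det ^+ 2.
  by rewrite det_mx22 !gE /coframe_det; ring.
move: g_unit; rewrite unitmxE unitfE detE.
by apply: contraNneq => ->; rewrite expr0n mulr0.
Qed.

Lemma coframe_free (a b : R) :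
  (forall i, a * ell F z i + b * m z i = 0) -> a = 0 /\ b = 0.
Proof.
move=> ab0; have d0 := coframe_det_neq0.
have ad : a * coframe_det = 0.
  transitivity (m z 1 * (a * ell F z 0 + b * m z 0)
                - m z 0 * (a * ell F z 1 + b * m z 1)).
    by rewrite /coframe_det; ring.
  by rewrite !ab0 !mulr0 subr0.
have bd : b * coframe_det = 0.
  transitivity (ell F z 0 * (a * ell F z 1 + b * m z 1)
                - ell F z 1 * (a * ell F z 0 + b * m z 0)).
    by rewrite /coframe_det; ring.
  by rewrite !ab0 !mulr0 subr0.
by split; apply: (mulIf d0); rewrite mul0r.
Qed.

(** The components [(f_{;1}, f_{;2})] exist (Cramer's rule), so the choice made
    by [vderiv] does satisfy its defining equation. *)
Lemma vderivP (f : TR2 R -> R) i :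
  F z * vpartial i f z = vderiv1 F m f z * ell F z i + vderiv2 F m f z * m z i.
Proof.
have d0 := coframe_det_neq0.
pose v j := F z * vpartial j f z.
pose a := (v 0 * m z 1 - v 1 * m z 0) / coframe_det.
pose b := (ell F z 0 * v 1 - ell F z 1 * v 0) / coframe_det.
pose P : set (R * R) := [set ab |
  forall i, F z * vpartial i f z = ab.1 * ell F z i + ab.2 * m z i].
suff Pab : P (a, b).
  have Pv : P (vderiv F m f z) by apply: getPex; exists (a, b).
  exact: Pv.
move=> j; apply: (mulIf d0); rewrite /= mulrDl.
rewrite [a * _ * _]mulrAC [b * _ * _]mulrAC /a /b !divfK //.
have : j = 0 \/ j = 1.
  by case: j => [[|[|//]] ?]; [left | right]; apply/val_inj.
by case=> ->; rewrite /coframe_det /v; ring.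
Qed.

Lemma gmetric_m_up i : \sum_j gmetric F z i j * m_up F m z j = m z i.
Proof.
pose mc : 'cV[R]_2 := \col_j m z j.
have upE j : m_up F m z j = (invmx (gmetric F z) *m mc) j 0.
  by rewrite mxE; apply: eq_bigr => k _; rewrite mxE.
under eq_bigr do rewrite upE.
by have := mulKVmx g_unit mc => /matrixP /(_ i 0); rewrite !mxE.
Qed.

(** The vector [m^i] is dual to [m] up to [eps] and annihilated by [l]: this is
    [g_ij m^j = m_i] read on the coframe. *)
Lemma m_up_dual :
  \sum_i ell F z i * m_up F m z i = 0 /\
  eps * (\sum_i m z i * m_up F m z i) = 1.
Proof.
set lu := \sum_i _; set mu := \sum_i _.
suff /coframe_free[-> /subr0_eq ->] :
  forall i, lu * ell F z i + (eps * mu - 1) * m z i = 0; first by [].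
move=> i; rewrite mulrBl mul1r addrA; apply/eqP; rewrite subr_eq0; apply/eqP.
rewrite -[RHS]gmetric_m_up /lu /mu mulr_sumr !mulr_suml -big_split /=.
by apply: eq_bigr => j _; rewrite gE; ring.
Qed.

Lemma contract_m_up (f : TR2 R -> R) :
  eps * (F z * \sum_i vpartial i f z * m_up F m z i) = vderiv2 F m f z.
Proof.
have [lu mu] := m_up_dual.
have -> : F z * (\sum_i vpartial i f z * m_up F m z i) =
    vderiv1 F m f z * (\sum_i ell F z i * m_up F m z i)
    + vderiv2 F m f z * (\sum_i m z i * m_up F m z i).
  rewrite !mulr_sumr -big_split /=; apply: eq_bigr => i _.
  by rewrite mulrA vderivP; ring.
by rewrite lu mulr0 add0r mulrCA mu mulr1.
Qed.

End BerwaldFrameAtPoint.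

(** The components [I_{;2} m_j m_k m_r / F] shared by both tensors. *)
Definition Ttensor3 (R : realType) (F : TR2 R -> R) (m : TR2 R -> 'I_2 -> R)
    (z : TR2 R) (j k r : 'I_2) : R :=
  vderiv2 F m (main_scalar F m) z * m z j * m z k * m z r / F z.

Lemma Ttensor_Ttensor3 (R : realType) (F : TR2 R -> R)
    (m : TR2 R -> 'I_2 -> R) (z : TR2 R) (i j k h : 'I_2) :
  Ttensor F m z i j k h = m z i * Ttensor3 F m z j k h.
Proof. by rewrite /Ttensor /Ttensor3; ring. Qed.

Lemma contract_Ttensor_up (R : realType) (F f : TR2 R -> R)
    (m : TR2 R -> 'I_2 -> R) (z : TR2 R) (j k r : 'I_2) :
  \sum_i vpartial i f z * Ttensor_up F m z i j k r =
  (\sum_i vpartial i f z * m_up F m z i) * Ttensor3 F m z j k r.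
Proof.
rewrite mulr_suml; apply: eq_bigr => i _.
by rewrite /Ttensor_up /Ttensor3; ring.
Qed.

Theorem lemma4p11 (R : realType) (M : topologicalType)
    (S : smooth_surface R M) (A : set (tangent S)) (F : tangent S -> R)
    (hF : conic_pseudo_finsler A F) (B : berwald_frame A F)
    (phi Fbar : tangent S -> R)
    (hphi : anisotropic_conformal_change B phi Fbar)
    (hproper : proper_change B phi) :
  vertical_phiT_condition B phi <-> vanishing_Ttensor B.
Proof.
split=> [phiT c z i j k h Az | T0 c z j k r Az].
- have := phiT c z j k h Az; rewrite contract_Ttensor_up Ttensor_Ttensor3.
  move/eqP; rewrite mulf_eq0 => /orP[/eqP s0 | /eqP ->]; last exact: mulr0.
  case: (hproper c z Az); rewrite /frame_vderiv2.
  rewrite -(contract_m_up (finsler_nondegenerate hF Az)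
    (fun i j => frame_metric B i j Az)).
  by rewrite s0 !mulr0.
- rewrite contract_Ttensor_up.
  have := T0 c z j j k r Az; rewrite Ttensor_Ttensor3.
  move/eqP; rewrite mulf_eq0 => /orP[/eqP mj0 | /eqP ->]; last exact: mulr0.
  by rewrite /Ttensor3 mj0 mulr0 !mul0r mulr0.
Qed.
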